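(* Let $m\ge 3$ and let $\mathfrak g$ be the simple Lie algebra of type $D_m$. Define permutations $r_k$ ($1\le k\le m$) of $B(n\varpi_1)$ recursively from the toggles by $$r_m=t_m,\qquad r_{m-1}=t_{m-1},\qquad r_k=r_{k+1}\,t_k\,r_{k+1}\,t_k\,r_{k+1}\quad (1\le k\le m-2).$$ Then for every $k\in\{1,\dots,m\}$ the single-node cactus generator $c_k=c_{\{k\}}$ acts on $B(n\varpi_1)$ in the same way as $r_k$, for every $n\ge 1$; that is, $c_k\sim r_k$.
   Context: Setting. $I=\{1,\dots,m\}$ is the Dynkin diagram of type $D_m$ with spin nodes $m-1,m$ (both adjacent to $m-2$; $i$ is adjacent to $i+1$ for $i\le m-2$), $\alpha_i=\epsilon_i-\epsilon_{i+1}$ for $i\le m-1$, $\alpha_m=\epsilon_{m-1}+\epsilon_m$, $W=\langle s_i\rangle$ is the Weyl group. The crystal $B(n\varpi_1)$ is the set of rows $b_1b_2\cdots b_n$ of length $n$, weakly increasing in the poset $1<2<\dots<m-1<m,\overline m<\overline{m-1}<\dots<\overline 1$ in which $m$ and $\overline m$ are incomparable (so $m,\overline m$ never both appear). The weight is the sum of the weights of the entries, $\mathrm{wt}(i)=\epsilon_i$, $\mathrm{wt}(\overline i)=-\epsilon_i$. On single letters: $f_i(i)=i+1$, $f_i(\overline{i+1})=\overline i$ for $1\le i\le m-1$; $f_m(m-1)=\overline m$, $f_m(m)=\overline{m-1}$; all other $f_i$ of letters are $0$; $e_i(x)=y$ iff $f_i(y)=x$. On a row, for fixed $i$, write from left to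 right a $+$ for each letter $x$ with $f_i(x)\ne0$ and a $-$ for each letter with $e_i(x)\neq 0$, successively cancel pairs $-+$, leaving $+\cdots+-\cdots-$; $f_i$ applies $f_i$ to the letter of the rightmost uncancelled $+$ (result $0$ if none) and $e_i$ applies $e_i$ to the letter of the leftmost uncancelled $-$ (result $0$ if none). Cactus action. For connected $J\subseteq I$ let $w_{0,J}$ be the longest element of $W_J=\langle s_j: j\in J\rangle$ and $\theta_J:J\to J$ be given by $\alpha_{\theta_J(j)}=-w_{0,J}\alpha_j$. Then $c_J$ acts on $B(n\varpi_1)$ as the unique map preserving each connected component of the crystal restricted to $J$ (keep only edges labelled by $J$) and satisfying $\mathrm{wt}(c_J b)=w_{0,J}\mathrm{wt}(b)$, $e_j c_J(b)=c_J(f_{\theta_J(j)}b)$, $f_jc_J(b)=c_J(e_{\theta_J(j)}b)$ for $j\in J$ (with $c_J(0)=0$). In particular $c_k=c_{\{k\}}$ reverses each $k$-string. Toggles (acting on $B(n\varpi_1)$; after each operation the entries are re-sorted into a row). For $1\le i\le m-2$, $t_i$ replaces every $i$ by $i+1$ and vice versa, and every $\overline i$ by $\overline{i+1}$ and vice versa. $t_{m-1}$ interchanges $m-1\leftrightarrow m$ and $\overline{m-1}\leftrightarrow\overline m$, and then replaces pairs consisting of one $m$ and one $\overline m$ by pairs consisting of one $m-1$ and one $\overline{m-1}$ until $m,\overline m$ do not both occur. $t_m$ interchanges $m-1\leftrightarrow\overline m$ and $m\leftrightarrow\overline{m-1}$ and then replaces pairs $m,\overline m$ by pairs $m-1,\overline{m-1}$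 in the same way. Products are compositions of maps (rightmost applied first), and $\sim$ means equality as maps on $B(n\varpi_1)$ for all $n\ge1$. *)

(* Defs.v *)
From HB Require Import structures.
From mathcomp Require Import all_boot all_order all_fingroup all_algebra.
From mathcomp Require Import zify.

Set Implicit Arguments.
Unset Strict Implicit.
Unset Printing Implicit Defensive.

Import GRing.Theory.

(* Node i of the Dynkin diagram D_m, and likewise epsilon_i, is represented by
   the ordinal of value i - 1 in 'I_m.  So the spin nodes m-1 and m are the
   ordinals of values m - 2 and m - 1.  The definitions make sense for every m,
   but describe type D_m only for 3 <= m. *)
Section TypeD.

Variable m : nat.

Definition is_last (i : 'I_m) : bool := i.+1 == m.

(* alpha_i = eps_(lo i) - eps_(hi i) if i is not the last node m, and
   alpha_m = eps_(lo m) + eps_(hi m); that is, (lo i, hi i) is (i, i+1) for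
   i < m and (m-1, m) for i = m.  (ordS and ord_pred are cyclic, but never wrap
   around here.) *)
Definition lo (i : 'I_m) : 'I_m := if is_last i then ord_pred i else i.
Definition hi (i : 'I_m) : 'I_m := if is_last i then i else ordS i.

Section Weights.
Local Open Scope ring_scope.

Definition weight : Type := 'rV[int]_m.

Definition eps (i : 'I_m) : weight := delta_mx 0 i.

Definition simple_root (i : 'I_m) : weight :=
  if is_last i then eps (lo i) + eps (hi i) else eps (lo i) - eps (hi i).

Definition dot (v w : weight) : int := \sum_(i < m) v 0 i * w 0 i.

(* Every root has square length 2, so it is its own coroot under dot. *)
Definition simple_reflection (i : 'I_m) (v : weight) : weight :=
  v - dot v (simple_root i) *: simple_root i.

(* The word [:: i1; ...; il] stands for s_i1 ... s_il. *)
Definition weyl_act (w : seq 'I_m) (v : weight) : weight :=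
  foldr simple_reflection v w.

Definition reduced_word (J : {set 'I_m}) (w : seq 'I_m) : Prop :=
  {subset w <= J} /\
  forall w' : seq 'I_m,
    {subset w' <= J} -> weyl_act w' =1 weyl_act w -> (size w <= size w')%N.

(* w is a reduced word of the longest element w_(0,J) of W_J. *)
Definition longest_word (J : {set 'I_m}) (w : seq 'I_m) : Prop :=
  reduced_word J w /\
  forall w' : seq 'I_m, reduced_word J w' -> (size w' <= size w)%N.

End Weights.

(* (i, false) is the letter i and (i, true) the letter i-bar. *)
Definition letter : Type := ('I_m * bool)%type.

Definition letter_le (x y : letter) : bool :=
  match x, y with
  | (i, false), (j, false) => i <= j
  | (i, false), (j, true) => ~~ (is_last i && is_last j)
  | (i, true), (j, true) => j <= i
  | (_, true), (_, false) => false
  end.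

Definition letter_f (i : 'I_m) (x : letter) : option letter :=
  if is_last i then
    if x == (lo i, false) then Some (hi i, true)
    else if x == (hi i, false) then Some (lo i, true)
    else None
  else
    if x == (lo i, false) then Some (hi i, false)
    else if x == (hi i, true) then Some (lo i, true)
    else None.

Definition letter_e (i : 'I_m) (x : letter) : option letter :=
  [pick y : letter | letter_f i y == Some x].

Definition letter_wt (x : letter) : weight :=
  (if x.2 then - eps x.1 else eps x.1)%R.

(* A linear extension of letter_le, used to re-sort. *)
Definition letter_rank (x : letter) : nat :=
  if x.2 then m.*2.-1 - x.1 else x.1.

Definition letter_toggle (i : 'I_m) (x : letter) : letter :=
  if x.1 \in [:: lo i; hi i] then
    (tperm (lo i) (hi i) x.1, if is_last i then ~~ x.2 else x.2)
  else x.

(* Replaces one pair b, b-bar by a pair a, a-bar, if possible. *)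
Definition replace_pair (a b : 'I_m) (s : seq letter) : seq letter :=
  if ((b, false) \in s) && ((b, true) \in s) then
    [:: (a, false), (a, true) & rem (b, false) (rem (b, true) s)]
  else s.

(* If a is not b, size s iterations remove all the pairs. *)
Definition replace_pairs (a b : 'I_m) (s : seq letter) : seq letter :=
  iter (size s) (replace_pair a b) s.

(* hi i is the last index exactly when i is one of the spin nodes m-1, m. *)
Definition toggle_seq (i : 'I_m) (s : seq letter) : seq letter :=
  let s' := map (letter_toggle i) s in
  sort (relpre letter_rank leq)
    (if is_last (hi i) then replace_pairs (lo i) (hi i) s' else s').

(* Stacks of the positions, among those read so far, of the uncancelled + and
   of the uncancelled -, with the rightmost position on top.  A - followed by a
   + is cancelled. *)
Definition signature_step n (i : 'I_m) (b : n.-tuple letter)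
    (st : seq 'I_n * seq 'I_n) (p : 'I_n) : seq 'I_n * seq 'I_n :=
  if letter_f i (tnth b p) then
    if st.2 is _ :: minus then (st.1, minus) else (p :: st.1, st.2)
  else if letter_e i (tnth b p) then (st.1, p :: st.2)
  else st.

Definition signature n (i : 'I_m) (b : n.-tuple letter) :
    seq 'I_n * seq 'I_n :=
  foldl (signature_step i b) ([::], [::]) (enum 'I_n).

Definition apply_at n (g : letter -> option letter) (b : n.-tuple letter)
    (p : 'I_n) : option (n.-tuple letter) :=
  omap (fun y => [tuple if q == p then y else tnth b q | q < n])
    (g (tnth b p)).

Definition tuple_f n (i : 'I_m) (b : n.-tuple letter) :=
  obind (apply_at (letter_f i) b) (ohead (signature i b).1).

Definition tuple_e n (i : 'I_m) (b : n.-tuple letter) :=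
  obind (apply_at (letter_e i) b) (ohead (rev (signature i b).2)).

Lemma letter_le_refl : reflexive letter_le.
Proof. by case=> i [] /=. Qed.

Lemma letter_le_trans : transitive letter_le.
Proof.
move=> [j b2] [i b1] [k b3]; have := ltn_ord i; have := ltn_ord j.
have := ltn_ord k; rewrite /letter_le /is_last.
case: b1 => //; case: b2 => //; case: b3 => //; lia.
Qed.


Lemma letter_le_anti : antisymmetric letter_le.
Proof.
move=> [i b1] [j b2]; case: b1; case: b2; rewrite /= ?andbF // => H;
  by congr pair; apply/val_inj/eqP; rewrite eqn_leq // andbC.
Qed.

Lemma letter_eP (i : 'I_m) (x y : letter) :
  letter_e i x = Some y -> letter_f i y = Some x.
Proof. by rewrite /letter_e; case: pickP => // z /eqP <- [<-]. Qed.

Lemma val_lo_hi (i : 'I_m) : 3 <= m ->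
  if is_last i then (lo i = m - 2 :> nat) /\ (hi i = m.-1 :> nat)
  else (lo i = i :> nat) /\ (hi i = i.+1 :> nat).
Proof.
move=> hm; have := ltn_ord i; rewrite /lo /hi /is_last.
case: eqP => [e _|ne lt]; split => //=.
- by rewrite (_ : (i + m).-1 = m - 2 + m); [rewrite modnDr modn_small | ]; lia.
- by lia.
- by rewrite modn_small //; lia.
Qed.

Lemma lo_neq_hi (i : 'I_m) : 3 <= m -> lo i != hi i.
Proof.
by move=> hm; rewrite -val_eqE /=; have := val_lo_hi i hm; case: ifP; lia.
Qed.


(* The letters with a nonzero f_i are src1, src2, with images tgt1, tgt2. *)
Definition src1 (i : 'I_m) : letter := (lo i, false).
Definition src2 (i : 'I_m) : letter := (hi i, ~~ is_last i).
Definition tgt1 (i : 'I_m) : letter := (hi i, is_last i).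
Definition tgt2 (i : 'I_m) : letter := (lo i, true).

Lemma letter_fE (i : 'I_m) (x : letter) :
  letter_f i x = if x == src1 i then Some (tgt1 i)
                 else if x == src2 i then Some (tgt2 i) else None.
Proof. by rewrite /letter_f /src1 /src2 /tgt1 /tgt2; case: is_last. Qed.


Lemma letter_e_None (i : 'I_m) (x : letter) : 3 <= m ->
  letter_e i x = None -> x != tgt1 i /\ x != tgt2 i.
Proof.
move=> hm; rewrite /letter_e; case: pickP => // H _.
split; apply/eqP=> xE; subst x.
  by have := H (src1 i); rewrite letter_fE !eqxx.
have := H (src2 i); rewrite letter_fE eqxx ifN ?eqxx //.
by rewrite xpair_eqE eq_sym negb_and lo_neq_hi.
Qed.

(* The crystal edges are covers, up to the incomparability of m and m-bar. *)
Lemma letter_f_cover (i : 'I_m) (x y z : letter) : 3 <= m ->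
  letter_f i x = Some y ->
  [/\ letter_le x y, letter_f i y = None,
     letter_le x z -> z != x -> letter_f i z = None -> letter_le y z &
     letter_le z y -> z != y -> letter_e i z = None -> letter_le z x].
Proof.
move=> hm; have e0 := @letter_e_None i z hm.
have vi := val_lo_hi i hm; have lti := ltn_ord i; have ltz := ltn_ord z.1.
rewrite !letter_fE; case: ifP => [/eqP -> [<-]|_].
  split.
  - by rewrite /src1 /tgt1 /is_last /=; move: vi; rewrite /is_last;
      case: eqP; lia.
  - by rewrite !ifN // /src1 /src2 /tgt1 xpair_eqE -!val_eqE /=; move: vi;
      rewrite /is_last; case: eqP; lia.
  - rewrite /src1 /src2 /tgt1; case: z e0 ltz => z bz e0 /= ltz.
    rewrite !xpair_eqE -!val_eqE /=; move: vi; rewrite /is_last.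
    by case: eqP; case: bz {e0} => //=; case: ifP => //; case: ifP => //; lia.
  - move=> h1 h2 /e0 [h3 h4]; move: h1 h2 h3 h4 {e0}.
    rewrite /src1 /src2 /tgt1 /tgt2; case: z ltz => z bz /= ltz.
    rewrite !xpair_eqE -!val_eqE /=; move: vi; rewrite /is_last.
    by case: eqP; case: bz => //=; lia.
case: ifP => [/eqP -> [<-]|//].
  split.
  - by rewrite /src2 /tgt2 /is_last /=; move: vi; rewrite /is_last;
      case: eqP => /=; lia.
  - by rewrite !ifN // /src1 /src2 /tgt2 xpair_eqE -!val_eqE /=; move: vi;
      rewrite /is_last; case: eqP; lia.
  - rewrite /src1 /src2 /tgt2; case: z e0 ltz => z bz e0 /= ltz.
    rewrite !xpair_eqE -!val_eqE /=; move: vi; rewrite /is_last.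
    by case: eqP; case: bz {e0} => //=; case: ifP => //; case: ifP => //; lia.
  - move=> h1 h2 /e0 [h3 h4]; move: h1 h2 h3 h4 {e0}.
    rewrite /src1 /src2 /tgt1 /tgt2; case: z ltz => z bz /= ltz.
    rewrite !xpair_eqE -!val_eqE /=; move: vi; rewrite /is_last.
    by case: eqP; case: bz => //=; lia.
Qed.


Lemma tuple_sortedP n (b : n.-tuple letter) :
  reflect (forall p q : 'I_n, p < q -> letter_le (tnth b p) (tnth b q))
    (sorted letter_le b).
Proof.
apply: (iffP idP) => [sb p q ltpq|H].
  have x0 := tnth b p; rewrite !(tnth_nth x0).
  have := sorted_leq_nth letter_le_trans letter_le_refl x0 sb.
  by apply; rewrite ?inE ?size_tuple // ltnW.
rewrite (sorted_pairwise letter_le_trans).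
case: n b H => [|n] b H; first by rewrite tuple0.
move: (tnth b ord0) => x0; apply/(pairwiseP x0) => p q; rewrite !inE size_tuple => ltp ltq ltpq.
by have := H (Ordinal ltp) (Ordinal ltq) ltpq; rewrite !(tnth_nth x0).
Qed.

Lemma sorted_apply_at n (g : letter -> option letter) (b b' : n.-tuple letter)
    (p : 'I_n) :
  sorted letter_le b -> apply_at g b p = Some b' ->
  (forall (q : 'I_n) y, g (tnth b p) = Some y ->
     (q < p -> letter_le (tnth b q) y) /\ (p < q -> letter_le y (tnth b q))) ->
  sorted letter_le b'.
Proof.
move=> /tuple_sortedP sb; rewrite /apply_at.
case: (g _) => //= y [<-] H; apply/tuple_sortedP => q r ltqr.
rewrite !tnth_mktuple; case: eqP ltqr => [->|_] ltqr; case: eqP ltqr => [->|_].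
- by rewrite ltnn.
- by move=> ltpr; case: (H r y erefl) => _; apply.
- by move=> ltqp; case: (H q y erefl) => + _; apply.
- exact: sb.
Qed.

Lemma signature_inv n (i : 'I_m) (b : n.-tuple letter) (l : seq 'I_n) :
  pairwise (fun p q : 'I_n => p < q) l ->
  let st := foldl (signature_step i b) ([::], [::]) l in
  let plus q := letter_f i (tnth b q) : bool in
  let minus q := ~~ plus q && letter_e i (tnth b q) in
  [/\ (forall p, ohead st.1 = Some p ->
        [/\ p \in l, plus p, (forall q, q \in st.2 -> p < q) &
         forall q, q \in l -> p < q -> plus q ->
         exists2 r, minus r & p < r < q]),
      (forall q, q \in st.2 -> (q \in l) && minus q),
      (st.2 = [::] -> forall q, q \in l -> minus q ->
        exists2 r, plus r & (q < r) && (r \in l)) &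
      (forall p, ohead (rev st.2) = Some p ->
        forall q, q \in l -> q < p -> minus q ->
        exists2 r, plus r & q < r < p)].
Proof.
elim/last_ind: l => [|l x IH] //.
rewrite -cats1 pairwise_cat /= allrel1r andbT => /andP[/allP ltx /IH {IH}].
rewrite foldl_cat /=; set st := foldl _ _ _.
pose plus q := letter_f i (tnth b q) : bool.
pose minus q := ~~ plus q && letter_e i (tnth b q).
move=> [I1 I2 I3 I4].
have in1 q : (q \in l ++ [:: x]) = (q \in l) || (q == x).
  by rewrite mem_cat inE.
rewrite /signature_step; case: ifP => px.
  case st2: st.2 => [|r0 s] /=.
    split => //.
    - move=> p [<-]; split => // [|q]; first by rewrite in1 eqxx orbT.
      by rewrite in1 => /orP[/ltx|/eqP ->]; lia.
    - move=> _ q; rewrite in1 => /orP[ql _|/eqP ->]; last first.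
        by rewrite /minus /plus px.
      by exists x => //; rewrite in1 eqxx orbT ltx.
  rewrite st2 in I1 I2 I3 I4; split => /=.
  - move=> p /I1 [pl pp H1 H2]; split => //.
    + by rewrite in1 pl.
    + by move=> q qs; apply: H1; rewrite inE qs orbT.
    + move=> q; rewrite in1 => /orP[/H2//|/eqP -> _ _].
      have /andP[r0l mr0] := I2 r0 (mem_head _ _).
      by exists r0 => //; rewrite H1 ?mem_head // ltx.
  - move=> q qs; rewrite in1.
    by have /I2/andP[-> ->] : q \in r0 :: s by rewrite inE qs orbT.
  - move=> _ q; rewrite in1 => /orP[ql _|/eqP ->]; last first.
      by rewrite /minus /plus px.
    by exists x => //; rewrite in1 eqxx orbT ltx.
  - move=> p; case/lastP: s {st2} I1 I2 I3 I4 => // s z I1 I2 I3 I4.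
    rewrite rev_rcons /= => -[<-] q; rewrite in1 => /orP[ql|/eqP ->].
      by apply: I4 => //; rewrite -rcons_cons rev_rcons.
    have /andP[/ltx zl _] : (z \in l) && minus z.
      by apply: I2; rewrite -rcons_cons mem_rcons mem_head.
    by move=> ltxz; have := ltn_trans zl ltxz; rewrite ltnn.
case: ifP => ex /=.
  have mx : minus x by rewrite /minus /plus px ex.
  split => //=.
  - move=> p /I1 [pl pp H1 H2]; split => //.
    + by rewrite in1 pl.
    + by move=> q; rewrite inE => /orP[/eqP ->|/H1 //]; apply: ltx.
    + by move=> q; rewrite in1 => /orP[/H2//|/eqP -> _]; rewrite /plus px.
  - move=> q; rewrite inE in1 => /orP[/eqP ->|/I2 /andP[-> ->//]].
    by rewrite eqxx orbT.
  - have [st2|[s [z st2]]] : st.2 = [::] \/ exists s z, st.2 = rcons s z.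
      by case/lastP: (st.2) => [|s z]; [left | right; exists s, z].
      rewrite st2 => p [<-] q; rewrite in1 => /orP[ql _ mq|/eqP ->]; last by rewrite ltnn.
      have [r pr /andP[qr rl]] := I3 st2 q ql mq.
      by exists r => //; rewrite qr ltx.
    rewrite st2 => p; rewrite -rcons_cons rev_rcons => -[<-] q; rewrite in1 => /orP[ql|/eqP ->].
      by apply: I4 => //; rewrite st2 rev_rcons.
    have /andP[/ltx zl _] : (z \in l) && minus z.
      by apply: I2; rewrite st2 mem_rcons mem_head.
    by move=> ltxz; have := ltn_trans zl ltxz; rewrite ltnn.
split => //.
- move=> p /I1 [pl pp H1 H2]; split => //.
  + by rewrite in1 pl.
  + by move=> q; rewrite in1 => /orP[/H2//|/eqP -> _]; rewrite /plus px.
- by move=> q /I2 /andP[ql ->]; rewrite in1 ql.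
- move=> /I3 H q; rewrite in1 => /orP[ql mq|/eqP ->]; last by rewrite px ex.
  by have [r pr /andP[qr rl]] := H q ql mq; exists r => //; rewrite qr in1 rl.
- move=> p /I4 H q; rewrite in1 => /orP[/H//|/eqP ->]; by rewrite px ex.
Qed.

Lemma signatureP n (i : 'I_m) (b : n.-tuple letter) :
  let plus q := letter_f i (tnth b q) : bool in
  let minus q := ~~ plus q && letter_e i (tnth b q) in
  (forall p, ohead (signature i b).1 = Some p ->
     forall q : 'I_n, p < q -> plus q -> exists2 r, minus r & p < r < q) /\
  (forall p, ohead (rev (signature i b).2) = Some p ->
     forall q : 'I_n, q < p -> minus q -> exists2 r, plus r & q < r < p).
Proof.
move=> plus minus.
have /signature_inv : pairwise (fun p q : 'I_n => p < q) (enum 'I_n).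
  rewrite -(pairwise_map val ltn) val_enum_ord -(sorted_pairwise ltn_trans).
  exact: iota_ltn_sorted.
move=> /(_ i b) [I1 _ _ I4]; split => p.
  by move=> /I1 [_ _ _ H] q; apply: H; rewrite mem_enum.
by move=> /I4 H q; apply: H; rewrite mem_enum.
Qed.

Lemma letter_e_f (i : 'I_m) (x y : letter) : 3 <= m ->
  letter_f i x = Some y -> letter_e i x = None.
Proof.
move=> hm fx; case ex: (letter_e i x) => [w|] //.
by have [_] := letter_f_cover x hm (letter_eP ex); rewrite fx.
Qed.

Lemma sorted_tuple_f n (i : 'I_m) (b b' : n.-tuple letter) : 3 <= m ->
  sorted letter_le b -> tuple_f i b = Some b' -> sorted letter_le b'.
Proof.
move=> hm sb; rewrite /tuple_f; have [+ _] := signatureP i b.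
case: (ohead _) => //= p /(_ p erefl) H /(sorted_apply_at sb); apply => q y fp.
have /tuple_sortedP lb := sb.
have [lxy fy Hz _] := letter_f_cover (tnth b q) hm fp.
split => [ltqp|ltpq]; first exact: letter_le_trans (lb _ _ ltqp) lxy.
case fq: (letter_f i (tnth b q)) => [z|]; last first.
  by apply: Hz => //; [exact: lb | apply: contra_eqN fq => /eqP ->; rewrite fp].
have [|r /andP[nr er] /andP[pr rq]] := H q ltpq; first by rewrite fq.
apply: letter_le_trans (lb _ _ rq).
have [_ _ + _] := letter_f_cover (tnth b r) hm fp; apply.
- exact: lb.
- by apply: contraNneq nr => ->; rewrite fp.
- by move: nr; case: (letter_f _ _).
Qed.

Lemma sorted_tuple_e n (i : 'I_m) (b b' : n.-tuple letter) : 3 <= m ->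
  sorted letter_le b -> tuple_e i b = Some b' -> sorted letter_le b'.
Proof.
move=> hm sb; rewrite /tuple_e; have [_] := signatureP i b.
case: (ohead _) => //= p /(_ p erefl) H /(sorted_apply_at sb); apply => q x ep.
have /tuple_sortedP lb := sb; have fx := letter_eP ep.
have [lxy fy _ Hz] := letter_f_cover (tnth b q) hm fx.
split => [ltqp|ltpq]; last exact: letter_le_trans lxy (lb _ _ ltpq).
case eq: (letter_e i (tnth b q)) => [z|]; last first.
  by apply: Hz => //; [exact: lb | apply: contra_eqN eq => /eqP ->; rewrite ep].
have [|r pr /andP[qr rp]] := H q ltqp.
  rewrite eq andbT; case fq: (letter_f i (tnth b q)) => [w|] //.
  by rewrite (letter_e_f hm fq) in eq.
apply: letter_le_trans (lb _ _ qr) _.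
have [_ _ _] := letter_f_cover (tnth b r) hm fx; apply.
- exact: lb.
- by apply: contraTneq pr => ->; rewrite fy.
- by move: pr; case fr: (letter_f _ _) => [w|] // _; apply: letter_e_f fr.
Qed.

Lemma perm_replace_pair (a b : 'I_m) (s : seq letter) :
  (b, false) \in s -> (b, true) \in s ->
  perm_eq s [:: (b, false), (b, true) & rem (b, false) (rem (b, true) s)].
Proof.
move=> h1 h2; rewrite perm_sym -(perm_catCA [:: (b, true)] [:: (b, false)]) /=.
rewrite perm_sym (perm_trans (perm_to_rem h2)) // perm_cons; apply: perm_to_rem.
have := perm_mem (perm_to_rem h2) (b, false); rewrite h1 inE => /esym.
by rewrite xpair_eqE andbF.
Qed.

Lemma size_replace_pair (a b : 'I_m) (s : seq letter) :
  size (replace_pair a b s) = size s.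
Proof.
rewrite /replace_pair; case: ifP => // /andP[h1 h2].
by rewrite (perm_size (perm_replace_pair a h1 h2)).
Qed.

Lemma size_toggle_seq (i : 'I_m) (s : seq letter) :
  size (toggle_seq i s) = size s.
Proof.
rewrite /toggle_seq size_sort; case: ifP => _; rewrite ?size_map //.
rewrite -[RHS](size_map (letter_toggle i)); set s' := map _ _.
have H k : size (iter k (replace_pair (lo i) (hi i)) s') = size s'.
  by elim: k => //= k IH; rewrite size_replace_pair.
exact: H.
Qed.

Lemma toggle_seq_subproof n (i : 'I_m) (b : n.-tuple letter) :
  size (toggle_seq i b) == n.
Proof. by rewrite size_toggle_seq size_tuple. Qed.

Definition toggle_tuple n (i : 'I_m) (b : n.-tuple letter) : n.-tuple letter :=
  Tuple (toggle_seq_subproof i b).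

Definition no_pair (b : 'I_m) (s : seq letter) : bool :=
  ~~ (((b, false) \in s) && ((b, true) \in s)).

Lemma replace_pairs_no_pair (a b : 'I_m) (s : seq letter) :
  a != b -> no_pair b (replace_pairs a b s).
Proof.
move=> ab; rewrite /replace_pairs.
have H k : no_pair b (iter k (replace_pair a b) s) \/
    count_mem (b, true) (iter k (replace_pair a b) s) + k <= size s.
  elim: k => [|k [IH|IH]]; first by right; rewrite addn0 count_size.
    by left; rewrite iterS /replace_pair ifN.
  rewrite iterS {1 3}/replace_pair; case: ifP => [/andP[h1 h2]|h]; last first.
    by left; rewrite /no_pair h.
  right; apply: leq_trans IH; rewrite addnS.
  have /seq.permP -> := perm_replace_pair a h1 h2.
  by rewrite /= !xpair_eqE !eqxx !andbF (negPf ab) /= !add0n add1n addSn.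
have [//|] := H (size s); rewrite -[X in _ <= X]add0n leq_add2r leqn0.
by rewrite /no_pair => /eqP/count_memPn/negPf ->; rewrite andbF.
Qed.

Lemma sorted_no_pair (b : 'I_m) (s : seq letter) :
  is_last b -> sorted letter_le s -> no_pair b s.
Proof.
move=> lb ss; apply/negP => /andP[/(nthP (b, true))[p ps ep] /(nthP (b, true))[q qs eq]].
have le := sorted_leq_nth letter_le_trans letter_le_refl (b, true) ss.
by have [/le|/le] := orP (leq_total p q); rewrite !inE ps qs ep eq /= ?lb => /(_ isT isT).
Qed.

Lemma sorted_sort_rank (s : seq letter) :
  (forall b, is_last b -> no_pair b s) ->
  sorted letter_le (sort (relpre letter_rank leq) s).
Proof.
move=> np.
have : sorted (relpre letter_rank leq) (sort (relpre letter_rank leq) s).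
  by apply: sort_sorted => x y; apply: leq_total.
apply: (sub_in_sorted (P := [in s])); last by apply/allP => x; rewrite mem_sort.
move=> [x bx] [y b'] xs ys; have := ltn_ord x; have := ltn_ord y.
rewrite /letter_rank /=; case: bx xs; case: b' ys => //= ys xs ltx lty.
- by lia.
- by rewrite /letter_le; move: ltx lty; lia.
move=> _; apply/negP => /andP[lx ly]; have xy : x = y.
  by apply/val_inj; move: lx ly; rewrite /is_last /=; lia.
by have := np x lx; rewrite /no_pair xs xy ys.
Qed.

Lemma sorted_toggle n (i : 'I_m) (b : n.-tuple letter) : 3 <= m ->
  sorted letter_le b -> sorted letter_le (toggle_tuple i b).
Proof.
move=> hm sb; apply: sorted_sort_rank => z lz; case: ifP => [lh|nlh].
  rewrite (_ : z = hi i); first exact/replace_pairs_no_pair/lo_neq_hi.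
  by apply/val_inj; move: lz lh; rewrite /is_last /=; lia.
have := sorted_no_pair lz sb; apply: contraNN.
have nl : ~~ is_last i by apply: contraFN nlh => li; rewrite /hi li.
have z_lo : z != lo i.
  by apply: contraTneq lz => ->; rewrite /lo (negPf nl).
have z_hi : z != hi i by apply: contraFneq nlh => <-.
have in_b c : (z, c) \in map (letter_toggle i) b -> (z, c) \in val b.
  move=> /mapP[[x c'] xb]; rewrite /letter_toggle /= !inE.
  case: ifP => [/orP[]/eqP -> [zE]|_ -> //].
    by rewrite zE tpermL eqxx in z_hi.
  by rewrite zE tpermR eqxx in z_lo.
by move=> /andP[/in_b -> /in_b ->].
Qed.

End TypeD.

(* B(n varpi_1) *)
Record row (m n : nat) : Type := Row {
  row_val :> n.-tuple (letter m);
  row_sorted : sorted (@letter_le m) row_val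
}.

HB.instance Definition _ m n := [isSub for @row_val m n].
HB.instance Definition _ m n := [Finite of row m n by <:].

Section Rows.

Variables m n : nat.
Implicit Types (b : row m n) (c : row m n -> row m n) (J : {set 'I_m}).

Definition row_wt b : weight m := (\sum_(p < n) letter_wt (tnth b p))%R.

(* None stands for 0.  By row_fE, row_eE and toggleE, applying an operator to a
   row always yields a row, so insub and insubd never take their default. *)
Definition row_f (i : 'I_m) b : option (row m n) := obind insub (tuple_f i b).

Definition row_e (i : 'I_m) b : option (row m n) := obind insub (tuple_e i b).

Definition toggle (i : 'I_m) b : row m n := insubd b (toggle_tuple i b).

Lemma row_fE (i : 'I_m) b : 3 <= m ->
  omap (@row_val m n) (row_f i b) = tuple_f i b.
Proof.
move=> hm; rewrite /row_f; case E: (tuple_f i b) => [b'|] //=.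
have sb' := sorted_tuple_f hm (row_sorted b) E.
by rewrite (insubT (fun s : n.-tuple _ => sorted (@letter_le m) s) sb').
Qed.

Lemma row_eE (i : 'I_m) b : 3 <= m ->
  omap (@row_val m n) (row_e i b) = tuple_e i b.
Proof.
move=> hm; rewrite /row_e; case E: (tuple_e i b) => [b'|] //=.
have sb' := sorted_tuple_e hm (row_sorted b) E.
by rewrite (insubT (fun s : n.-tuple _ => sorted (@letter_le m) s) sb').
Qed.

Lemma toggleE (i : 'I_m) b : 3 <= m ->
  toggle i b = toggle_seq i b :> seq (letter m).
Proof. by move=> hm; rewrite val_insubd sorted_toggle // row_sorted. Qed.

Definition crystal_edge J : rel (row m n) :=
  [rel b b' | [exists j in J, (row_f j b == Some b') || (row_f j b' == Some b)]].

(* c is the action of c_J on B(n varpi_1). *)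
Definition is_cactus_generator J c : Prop :=
  exists (w : seq 'I_m) (theta : 'I_m -> 'I_m),
    [/\ longest_word J w,
        forall j, j \in J -> theta j \in J /\
          simple_root (theta j) = (- weyl_act w (simple_root j))%R,
        forall b, connect (crystal_edge J) b (c b),
        forall b, row_wt (c b) = weyl_act w (row_wt b) &
        forall j b, j \in J ->
          row_e j (c b) = omap c (row_f (theta j) b) /\
          row_f j (c b) = omap c (row_e (theta j) b)].

Fixpoint r_rec (d : nat) (k : 'I_m) : row m n -> row m n :=
  if d is d'.+1 then
    let r' := r_rec d' (ordS k) in
    r' \o toggle k \o r' \o toggle k \o r'
  else toggle k.

(* The recursion depth is 0 at both spin nodes. *)
Definition r (k : 'I_m) : row m n -> row m n := r_rec (m - k.+2) k.

Lemma r_spin (k : 'I_m) : m <= k.+2 -> r k = toggle k.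
Proof. by rewrite /r -subn_eq0 => /eqP ->. Qed.

Lemma r_recE (k k' : 'I_m) : k.+2 < m -> k' = k.+1 :> nat ->
  r k = r k' \o toggle k \o r k' \o toggle k \o r k'.
Proof.
move=> ltk k'E; have -> : k' = ordS k.
  by apply/val_inj; rewrite /= k'E modn_small // ltnW.
by rewrite /r /= modn_small ?(ltnW ltk) // -subnSK.
Qed.

End Rows.

(* Main.v *)
From mathcomp Require Import all_boot all_fingroup all_algebra zify.
Require Import Defs.

(* Up to irrelevant letters, a row is src1^a tgt1^b src2^c tgt2^d for the node k
   (in either order in the middle if b = 0 or c = 0).  The signature rule then
   lowers (c, d) to (c - 1, d + 1) if b < c, and (a, b) to (a - 1, b + 1)
   otherwise, so that the k-string of a row is given by the invariants a + b,
   c + d and min(b, c), and the weight determines the position in it.  Hence c_k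
   is the only map with these invariants and a' - d' = b - c.  For a spin node
   min(b, c) = 0, and the toggle visibly has these properties; for the other
   nodes they follow inductively from an identity between piecewise linear
   functions of the numbers of letters k, k+1, k+2 and of their bars. *)

Set Implicit Arguments.
Unset Strict Implicit.
Unset Printing Implicit Defensive.

(** * Words, counts and the piecewise linear identity *)

Lemma nseq_cat_cons (T : Type) a (x : T) s :
  nseq a x ++ x :: s = x :: nseq a x ++ s.
Proof. by elim: a => //= a ->. Qed.

Lemma count_mem_tnth (T : eqType) n (t : n.-tuple T) x :
  count_mem x t = \sum_(p < n) (tnth t p == x).
Proof.
rewrite -sum1_count big_tuple big_mkcond.
by apply: eq_bigr => p _ /=; case: eqP.
Qed.

(** The arguments count [src1], [tgt1], [src2], [tgt2] before and after reversing a string; the last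
    equation is [a' - d' = b - c] written without subtraction. *)
Definition reversal4 (a b c d a' b' c' d' : nat) : Prop :=
  a' + b' = a + b /\ c' + d' = c + d /\
  minn b' c' = minn b c /\ a' + c = b + d'.

(* [ai] and [ci] count the letters k+i-1 and their bars in a row; [pi] and [qi],
   [ui] and [vi], [wi] and [zi] do so after the first, second and third factor
   r_{k+1}.  As t_k exchanges the indices 1 and 2, the second factor acts on the
   counts that had index 1, and the third one on those left by the first. *)
Lemma reversal4_braid
    (a1 a2 a3 c3 c2 c1 p2 p3 q3 q2 u2 u3 v3 v2 w2 w3 z3 z2 : nat) :
  reversal4 a2 a3 c3 c2 p2 p3 q3 q2 ->
  reversal4 a1 p3 q3 c1 u2 u3 v3 v2 ->
  reversal4 p2 u3 v3 q2 w2 w3 z3 z2 ->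
  w3 = a3 /\ z3 = c3 /\ reversal4 a1 a2 c2 c1 u2 w2 z2 v2.
Proof. by rewrite /reversal4; lia. Qed.

(** * The four letters of a node and its signature rule *)

Section Letters.

Variables (m : nat) (hm : 3 <= m).
Implicit Types (k : 'I_m) (x y z : letter m).

Definition node_letters k : seq (letter m) :=
  [:: src1 k; tgt1 k; src2 k; tgt2 k].

Lemma uniq_node_letters k : uniq (node_letters k).
Proof.
have := lo_neq_hi k hm; rewrite /= !inE /src1 /tgt1 /src2 /tgt2.
rewrite !xpair_eqE [hi k == lo k]eq_sym => /negPf ->.
by rewrite !eqxx; case: is_last.
Qed.

Lemma node_letter_neqs k :
  (((src1 k == tgt1 k) = false) * ((src1 k == src2 k) = false) *
   ((src1 k == tgt2 k) = false) * ((tgt1 k == src2 k) = false) *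
   ((tgt1 k == tgt2 k) = false) * ((src2 k == tgt2 k) = false) *
   ((tgt1 k == src1 k) = false) * ((src2 k == src1 k) = false) *
   ((tgt2 k == src1 k) = false) * ((src2 k == tgt1 k) = false) *
   ((tgt2 k == tgt1 k) = false) * ((tgt2 k == src2 k) = false))%type.
Proof.
have := uniq_node_letters k; rewrite /= !inE !negb_or.
case/and4P=> /and3P[/negPf h1 /negPf h2 /negPf h3].
case/andP=> /negPf h4 /negPf h5 /negPf h6 _.
by do !split; rewrite // eq_sym.
Qed.

Lemma letter_f_src1 k : letter_f k (src1 k) = Some (tgt1 k).
Proof. by rewrite letter_fE eqxx. Qed.

Lemma letter_f_src2 k : letter_f k (src2 k) = Some (tgt2 k).
Proof. by rewrite letter_fE node_letter_neqs eqxx. Qed.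

Lemma letter_f_None k x :
  x != src1 k -> x != src2 k -> letter_f k x = None.
Proof. by rewrite letter_fE => /negPf -> /negPf ->. Qed.

Lemma letter_e_tgt1 k : letter_e k (tgt1 k) = Some (src1 k).
Proof.
case E: letter_e => [y|]; last by have [] := letter_e_None hm E; rewrite eqxx.
have := letter_eP E; rewrite letter_fE; case: eqP => [->|_] //.
by case: eqP => // _ /Some_inj/eqP; rewrite node_letter_neqs.
Qed.

Lemma letter_e_tgt2 k : letter_e k (tgt2 k) = Some (src2 k).
Proof.
case E: letter_e => [y|]; last by have [] := letter_e_None hm E; rewrite eqxx.
have := letter_eP E; rewrite letter_fE.
case: eqP => [_ /Some_inj/eqP|_]; first by rewrite node_letter_neqs.
by case: eqP => // ->.
Qed.

Lemma letter_f_tgt k x : x \in [:: tgt1 k; tgt2 k] -> letter_f k x = None.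
Proof.
by rewrite !inE => /orP[]/eqP->; rewrite letter_f_None // node_letter_neqs.
Qed.

Lemma letter_e_off k x : x \notin node_letters k -> letter_e k x = None.
Proof.
move=> xk; case E: letter_e => [y|] //; move: (letter_eP E) xk.
rewrite letter_fE !inE.
case: eqP => [_ /Some_inj <-|_]; first by rewrite eqxx orbT.
by case: eqP => // _ /Some_inj <-; rewrite eqxx !orbT.
Qed.

(* The signature rule, with the stacks holding letters instead of positions. *)
Definition letter_step k (st : seq (letter m) * seq (letter m)) x :=
  if letter_f k x then
    if st.2 is _ :: minus then (st.1, minus) else (x :: st.1, st.2)
  else if letter_e k x then (st.1, x :: st.2)
  else st.

(** The counts of the new row depend only on which letter is changed, so the positions on the stacks
    can be forgotten. *)
Lemma map_signature n k (b : n.-tuple (letter m)) :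
  (map (tnth b) (signature k b).1, map (tnth b) (signature k b).2)
    = foldl (letter_step k) ([::], [::]) b.
Proof.
rewrite -[in RHS](map_tnth_enum b) /signature.
pose letters (st : seq 'I_n * seq 'I_n) :=
  (map (tnth b) st.1, map (tnth b) st.2).
suff foldlE l st : letters (foldl (signature_step k b) st l) =
    foldl (letter_step k) (letters st) (map (tnth b) l) by exact: foldlE.
elim: l st => //= p l IH st; rewrite IH; congr foldl.
rewrite /signature_step /letter_step.
case: st => P M; case: (letter_f k (tnth b p)) => [?|]; first by case: M.
by case: (letter_e k (tnth b p)).
Qed.

Lemma foldl_letter_step_filter k st (s : seq (letter m)) :
  foldl (letter_step k) st s =
  foldl (letter_step k) st (filter [in node_letters k] s).
Proof.
elim: s st => //= x s IH st; rewrite IH; case: ifP => // /negbT xk.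
suff -> : letter_step k st x = st by [].
rewrite /letter_step (letter_e_off xk) letter_f_None //;
  by apply: contraNneq xk => ->; rewrite !inE eqxx ?orbT.
Qed.

(** A run of + first cancels the - on the stack; only the surplus, a truncated difference, is
    pushed. *)
Lemma foldl_letter_step_plus k x a P M : letter_f k x ->
  foldl (letter_step k) (P, M) (nseq a x) =
    (nseq (a - size M) x ++ P, drop a M).
Proof.
move=> fx; elim: a P M => [|a IH] P M; first by rewrite drop0.
rewrite /= [letter_step _ _ _]/letter_step fx; case: M => [|y M] //=.
by rewrite IH /= !subn0 nseq_cat_cons.
Qed.

Lemma foldl_letter_step_minus k x a P M :
  letter_f k x = None -> letter_e k x ->
  foldl (letter_step k) (P, M) (nseq a x) = (P, nseq a x ++ M).
Proof.
move=> fx ex; elim: a M => //= a IH M.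
by rewrite [letter_step _ _ _]/letter_step fx ex IH nseq_cat_cons.
Qed.

End Letters.

(** * Rows as multisets of letters, and the invariants of a string *)

Section Counts.

Variables m n : nat.
Implicit Types (k : 'I_m) (x y z : letter m) (b : row m n).

Definition cnt x b : nat := count_mem x b.

Lemma row_eq b b' : (forall x, cnt x b = cnt x b') -> b = b'.
Proof.
move=> H; apply/val_inj/val_inj.
apply: (sorted_eq (@letter_le_trans m) (@letter_le_anti m)).
- exact: row_sorted.
- exact: row_sorted.
- by apply/allP => x _; apply/eqP; exact: H.
Qed.

(* For a spin node, tgt1 and src2 are the incomparable letters m and m-bar. *)
Lemma spin_counts k b : is_last (hi k) ->
  minn (cnt (tgt1 k) b) (cnt (src2 k) b) = 0.
Proof.
move=> lk; have := sorted_no_pair lk (row_sorted b).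
rewrite /no_pair /tgt1 /src2 negb_and /cnt => /orP[] /count_memPn;
  by case: (is_last k) => /= ->; rewrite ?min0n ?minn0.
Qed.

Definition eq_off k b b' : Prop :=
  forall z, z \notin node_letters k -> cnt z b' = cnt z b.

(** The equation expresses, without subtraction, that one [x] has been turned into one [y]. *)
Lemma count_node_letters k b b' x y :
    x \in node_letters k -> y \in node_letters k ->
    (forall z, cnt z b' + (x == z) = cnt z b + (y == z)) ->
  eq_off k b b'.
Proof.
move=> xk yk H z zk; have := H z.
have [-> ->] : (x == z) = false /\ (y == z) = false.
  by split; apply: contraNF zk => /eqP <-.
by lia.
Qed.

Lemma row_eq_node k b b' : eq_off k b b' ->
  cnt (src1 k) b' = cnt (src1 k) b -> cnt (tgt1 k) b' = cnt (tgt1 k) b ->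
  cnt (src2 k) b' = cnt (src2 k) b -> cnt (tgt2 k) b' = cnt (tgt2 k) b ->
  b' = b.
Proof.
move=> off h1 h2 h3 h4; apply: row_eq => x; rewrite -!/(cnt _ _).
case: (boolP (x \in node_letters k)) => [|/off //].
by rewrite !inE => /or4P[]/eqP ->.
Qed.

(* The third condition says that f_k and e_k preserve the number of cancelled
   pairs -+. *)
Definition same_string k b b' : Prop := eq_off k b b' /\
  [/\ cnt (src1 k) b' + cnt (tgt1 k) b' = cnt (src1 k) b + cnt (tgt1 k) b,
      cnt (src2 k) b' + cnt (tgt2 k) b' = cnt (src2 k) b + cnt (tgt2 k) b &
      minn (cnt (tgt1 k) b') (cnt (src2 k) b') =
        minn (cnt (tgt1 k) b) (cnt (src2 k) b)].

Lemma same_string_refl k b : same_string k b b.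
Proof. by []. Qed.

Lemma same_string_sym k b b' : same_string k b b' -> same_string k b' b.
Proof. by case=> off [h1 h2 h3]; split => // z /off. Qed.

Lemma same_string_trans k b2 b1 b3 :
  same_string k b1 b2 -> same_string k b2 b3 -> same_string k b1 b3.
Proof.
case=> off [h1 h2 h3] [off' [h1' h2' h3']].
by split; [move=> z zk; rewrite off' ?off | split; lia].
Qed.

(** If [a - d] agrees as well, the counts [a, b, c, d] change by [t, -t, -t, t] for some [t], and
    equality of the minima forces [t = 0]. *)
Lemma same_string_inj k b b' : same_string k b b' ->
  cnt (src1 k) b' + cnt (tgt2 k) b = cnt (src1 k) b + cnt (tgt2 k) b' ->
  b' = b.
Proof.
by case=> off [h1 h2 h3] h4; apply: row_eq_node off _ _ _ _; lia.
Qed.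

(* Given the other conditions, the last one exchanges the numbers of
   uncancelled + and -. *)
Definition reversal k b b' : Prop :=
  same_string k b b' /\
  cnt (src1 k) b' + cnt (src2 k) b = cnt (tgt1 k) b + cnt (tgt2 k) b'.

Lemma reversal_inj k b b1 b2 : reversal k b b1 -> reversal k b b2 -> b1 = b2.
Proof.
case=> ss1 h1 [ss2 h2].
have ss := same_string_trans (same_string_sym ss2) ss1.
by apply: (same_string_inj ss); case: ss => _ [? ? ?]; lia.
Qed.

(** Stated for any optional row [ob] so as to serve [row_f] and [row_e] alike. *)
Lemma count_apply_at (g : letter m -> option (letter m)) b (p : 'I_n)
    (ob : option (row m n)) x y :
  omap (@row_val m n) ob = apply_at g b p -> tnth b p = x -> g x = Some y ->
  exists2 b', ob = Some b' &
    forall z, cnt z b' + (x == z) = cnt z b + (y == z).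
Proof.
rewrite /apply_at => + px gx; rewrite px gx; case: ob => //= b' [b'E].
exists b' => // z.
rewrite /cnt !count_mem_tnth b'E (bigD1 p) //= [in RHS](bigD1 p) //=.
rewrite tnth_mktuple eqxx px.
rewrite addnC addnA [RHS]addnAC; congr (_ + _); apply: eq_bigr => q /negPf qp.
by rewrite tnth_mktuple qp.
Qed.

Lemma crystal_edge_sym J : symmetric (@crystal_edge m n J).
Proof.
by move=> b b'; apply/existsP/existsP => -[j /andP[jJ H]]; exists j;
  rewrite jJ orbC.
Qed.

(** * The crystal operators in terms of counts *)

Variable hm : 3 <= m.

Lemma filter_node_letters k b :
  filter [in node_letters k] b =
  nseq (cnt (src1 k) b) (src1 k) ++ nseq (cnt (tgt1 k) b) (tgt1 k) ++
  nseq (cnt (src2 k) b) (src2 k) ++ nseq (cnt (tgt2 k) b) (tgt2 k).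
Proof.
apply: (sorted_eq (@letter_le_trans m) (@letter_le_anti m)).
- exact/(sorted_filter (@letter_le_trans m))/row_sorted.
- rewrite (sorted_pairwise (@letter_le_trans m)).
  have pn a x : pairwise (@letter_le m) (nseq a x).
    elim: a => //= a ->; rewrite andbT; apply/allP => y /nseqP[-> _].
    exact: letter_le_refl.
  have an a c x y : letter_le x y \/ minn a c = 0 ->
      allrel (@letter_le m) (nseq a x) (nseq c y).
    move=> H; apply/allrelP => u v /nseqP[-> a0] /nseqP[-> c0].
    by case: H => //; lia.
  have := val_lo_hi k hm; have lk := ltn_ord k => vk.
  rewrite !pairwise_cat !allrel_catr !pn !an //.
  all: try by left; rewrite /letter_le /src1 /tgt1 /src2 /tgt2 /is_last /=;
      move: vk; rewrite /is_last; case: eqP => /=; lia.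
  (* For a spin node [tgt1 k] and [src2 k] are incomparable, but one of their blocks is empty. *)
  case: (boolP (is_last (hi k))) => lh; [right; exact: spin_counts | left].
  rewrite /letter_le /tgt1 /src2; move: vk lh; rewrite /is_last.
  by case: eqP => /=; lia.
- apply/allP => x _; apply/eqP; rewrite !count_cat !count_nseq /= count_filter.
  have E := node_letter_neqs hm k.
  case: (boolP (x \in node_letters k)) => xk.
    rewrite (_ : count _ _ = cnt x b); last first.
      by rewrite /cnt; apply: eq_count => y /=; case: eqP => // ->.
    by move: xk; rewrite !inE => /or4P[]/eqP ->;
      rewrite eqxx !E ?mul1n ?mul0n ?addn0.
  rewrite (_ : count _ _ = 0); last first.
    apply/eqP; rewrite -leqn0 leqNgt -has_count.
    by apply/hasP => -[y _ /= /andP[/eqP ->]]; apply/negP.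
  by move: xk; rewrite !inE !negb_or => /and4P[];
     rewrite ![_ == x]eq_sym => /negPf-> /negPf-> /negPf-> /negPf->.
Qed.

(** Only the - of [tgt1 k] and the + of [src2 k] cancel. The rightmost positions are on top, so
    [src2 k] and [tgt2 k] come first. *)
Lemma row_signature k b :
  (map (tnth b) (signature k b).1, map (tnth b) (signature k b).2) =
  (nseq (cnt (src2 k) b - cnt (tgt1 k) b) (src2 k) ++
     nseq (cnt (src1 k) b) (src1 k),
   nseq (cnt (tgt2 k) b) (tgt2 k) ++
     nseq (cnt (tgt1 k) b - cnt (src2 k) b) (tgt1 k)).
Proof.
rewrite map_signature foldl_letter_step_filter // filter_node_letters.
rewrite !foldl_cat foldl_letter_step_plus ?letter_f_src1 //= cats0.
rewrite foldl_letter_step_minus ?letter_e_tgt1 ?letter_f_tgt ?inE ?eqxx //.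
rewrite cats0 foldl_letter_step_plus ?letter_f_src2 // size_nseq drop_nseq.
by rewrite foldl_letter_step_minus ?letter_e_tgt2 ?letter_f_tgt ?inE ?eqxx ?orbT
  ?subn0.
Qed.

(** The rightmost uncancelled + is a [src2 k] if one of these survives the cancellation, and
    otherwise a [src1 k]. *)
Lemma row_fP k b :
  match row_f k b with
  | None => cnt (src1 k) b = 0 /\ cnt (src2 k) b <= cnt (tgt1 k) b
  | Some b' => eq_off k b b' /\
    if cnt (tgt1 k) b < cnt (src2 k) b then
      [/\ cnt (src1 k) b' = cnt (src1 k) b, cnt (tgt1 k) b' = cnt (tgt1 k) b,
          (cnt (src2 k) b').+1 = cnt (src2 k) b &
          cnt (tgt2 k) b' = (cnt (tgt2 k) b).+1]
    else
      [/\ (cnt (src1 k) b').+1 = cnt (src1 k) b,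
          cnt (tgt1 k) b' = (cnt (tgt1 k) b).+1,
          cnt (src2 k) b' = cnt (src2 k) b & cnt (tgt2 k) b' = cnt (tgt2 k) b]
  end.
Proof.
have E := node_letter_neqs hm k.
have := row_fE k b hm; rewrite /tuple_f; have [+ _] := row_signature k b.
case: (signature k b).1 => [|p s] /= sE.
  move/(congr1 size): sE; rewrite size_cat !size_nseq /=.
  by case: row_f => //; lia.
move=> ofE; case: ltnP => h.
  have px : tnth b p = src2 k by move: sE; rewrite -(subnSK h); case.
  have [b' -> cE] := count_apply_at ofE px (letter_f_src2 hm k).
  split; first by apply: count_node_letters cE; rewrite !inE eqxx ?orbT.
  by have := (cE (src1 k), cE (tgt1 k), cE (src2 k), cE (tgt2 k));
    rewrite !eqxx !E; case=> [[[]]] /= *; split; lia.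
have h0 : cnt (src2 k) b - cnt (tgt1 k) b = 0 by lia.
have px : tnth b p = src1 k by move: sE; rewrite h0; case: cnt => // a [].
have [b' -> cE] := count_apply_at ofE px (letter_f_src1 k).
split; first by apply: count_node_letters cE; rewrite !inE eqxx ?orbT.
by have := (cE (src1 k), cE (tgt1 k), cE (src2 k), cE (tgt2 k));
  rewrite !eqxx !E; case=> [[[]]] /= *; split; lia.
Qed.

Lemma row_eP k b :
  match row_e k b with
  | None => cnt (tgt2 k) b = 0 /\ cnt (tgt1 k) b <= cnt (src2 k) b
  | Some b' => eq_off k b b' /\
    if cnt (src2 k) b < cnt (tgt1 k) b then
      [/\ cnt (src1 k) b' = (cnt (src1 k) b).+1,
          (cnt (tgt1 k) b').+1 = cnt (tgt1 k) b,
          cnt (src2 k) b' = cnt (src2 k) b & cnt (tgt2 k) b' = cnt (tgt2 k) b]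
    else
      [/\ cnt (src1 k) b' = cnt (src1 k) b, cnt (tgt1 k) b' = cnt (tgt1 k) b,
          cnt (src2 k) b' = (cnt (src2 k) b).+1 &
          (cnt (tgt2 k) b').+1 = cnt (tgt2 k) b]
  end.
Proof.
have E := node_letter_neqs hm k.
have := row_eE k b hm; rewrite /tuple_e; have [_ +] := row_signature k b.
(* The leftmost uncancelled - is at the bottom of the stack: a [tgt1 k] if one survives, otherwise a
   [tgt2 k]. *)
move=> /(congr1 rev); rewrite -map_rev rev_cat !rev_nseq.
case: (rev (signature k b).2) => [|p s] /= sE.
  move/(congr1 size): sE; rewrite size_cat !size_nseq /=.
  by case: row_e => //; lia.
move=> oeE; case: ltnP => h.
  have px : tnth b p = tgt1 k by move: sE; rewrite -(subnSK h); case.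
  have [b' -> cE] := count_apply_at oeE px (letter_e_tgt1 hm k).
  split; first by apply: count_node_letters cE; rewrite !inE eqxx ?orbT.
  by have := (cE (src1 k), cE (tgt1 k), cE (src2 k), cE (tgt2 k));
    rewrite !eqxx !E; case=> [[[]]] /= *; split; lia.
have h0 : cnt (tgt1 k) b - cnt (src2 k) b = 0 by lia.
have px : tnth b p = tgt2 k by move: sE; rewrite h0; case: cnt => // a [].
have [b' -> cE] := count_apply_at oeE px (letter_e_tgt2 hm k).
split; first by apply: count_node_letters cE; rewrite !inE eqxx ?orbT.
by have := (cE (src1 k), cE (tgt1 k), cE (src2 k), cE (tgt2 k));
  rewrite !eqxx !E; case=> [[[]]] /= *; split; lia.
Qed.


(** The counts after [e_k] select the branch of [row_fP] that undoes the change. *)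
Lemma row_eK k b b' : row_e k b = Some b' -> row_f k b' = Some b.
Proof.
have := row_eP k b; case: row_e => // ? + [E]; rewrite E => -[off H].
have := row_fP k b'; case: row_f => [b2 [off' H']|]; last first.
  by case: ltnP H => ? [? ? ? ?]; lia.
congr Some; apply: (row_eq_node (k := k)) => [z zk|||| ].
  by rewrite off' ?off.
all: by case: ltnP H => ? [? ? ? ?]; case: ltnP H' => ? [? ? ? ?]; lia.
Qed.

Lemma same_string_f k b b' : row_f k b = Some b' -> same_string k b b'.
Proof.
have := row_fP k b; case: row_f => // ? + [E]; rewrite E => -[off H].
by split => //; case: ltnP H => ? [? ? ? ?]; split; lia.
Qed.

Lemma same_string_e k b b' : row_e k b = Some b' -> same_string k b b'.
Proof. by move/row_eK/same_string_f/same_string_sym. Qed.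

(** Induction on the number of letters [tgt1 k] and [tgt2 k], which [e_k] lowers by one. *)
Lemma connect_highest k b : exists b',
  [/\ connect (crystal_edge [set k]) b b', same_string k b b' &
      row_e k b' = None].
Proof.
have [N] := ubnP (cnt (tgt1 k) b + cnt (tgt2 k) b); elim: N b => // N IH b lt.
case E: (row_e k b) => [b1|]; last first.
  by exists b; split; [exact: connect0 | exact: same_string_refl |].
have [|b' [con ss e0]] := IH b1.
  by have := row_eP k b; rewrite E => -[_]; case: ltnP => ? [? ? ? ?]; lia.
exists b'; split => //; last exact: same_string_trans (same_string_e E) ss.
apply: connect_trans con; apply: connect1; apply/existsP; exists k.
by rewrite inE eqxx (row_eK E) eqxx orbT.
Qed.

(** Every edge preserves the invariants; conversely, rows with equal invariants are connected to the
    same highest row. *)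
Lemma connect_same_string k b b' :
  connect (crystal_edge [set k]) b b' <-> same_string k b b'.
Proof.
split=> [/connectP[p]|ss].
  elim: p b => [|b1 p IH] b /=; first by move=> _ ->; exact: same_string_refl.
  case/andP=> /existsP[j /andP[/set1P -> edge]] /IH H /H.
  apply: same_string_trans.
  by case/orP: edge => /eqP/same_string_f // /same_string_sym.
have [b1 [con1 ss1 e1]] := connect_highest k b.
have [b2 [con2 ss2 e2]] := connect_highest k b'.
suff E : b2 = b1.
  apply: connect_trans con1 _; rewrite -E.
  by rewrite (sym_connect_sym (@crystal_edge_sym _)).
have ss12 : same_string k b1 b2.
  exact: same_string_trans (same_string_sym ss1) (same_string_trans ss ss2).
(* At a highest row [d = 0] and [b <= c], so the minimum is [b] and the invariants fix all four
   counts. *)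
apply: (same_string_inj ss12); have := row_eP k b1; have := row_eP k b2.
by rewrite e1 e2; case: ss12 => _ [? ? ?] [? ?] [? ?]; lia.
Qed.

(** The counts show that both sides vanish together; otherwise both are reversals of [f_k b], hence
    equal. *)
Lemma reversal_e k (c : row m n -> row m n) b :
  (forall b, reversal k b (c b)) -> row_e k (c b) = omap c (row_f k b).
Proof.
move=> rev; have [[off [h1 h2 h3]] h4] := rev b.
have := row_fP k b; have := row_eP k (c b).
case: row_e => [b2|]; case: row_f => [b1|] //=.
- case=> off2 H2 [off1 H1]; congr Some; apply: reversal_inj (rev b1).
  case: ltnP H1 => ? [? ? ? ?]; case: ltnP H2 => ? [? ? ? ?];
    by split; [split; [move=> z zk; rewrite off2 ?off ?off1 | split; lia] | lia].
- by case=> _; case: ltnP => ? [? ? ? ?] [? ?]; lia.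
- by case=> ? ? [_]; case: ltnP => ? [? ? ? ?]; lia.
Qed.

Lemma reversal_f k (c : row m n -> row m n) b :
  (forall b, reversal k b (c b)) -> row_f k (c b) = omap c (row_e k b).
Proof.
move=> rev; have [[off [h1 h2 h3]] h4] := rev b.
have := row_eP k b; have := row_fP k (c b).
case: row_f => [b2|]; case: row_e => [b1|] //=.
- case=> off2 H2 [off1 H1]; congr Some; apply: reversal_inj (rev b1).
  case: ltnP H1 => ? [? ? ? ?]; case: ltnP H2 => ? [? ? ? ?];
    by split; [split; [move=> z zk; rewrite off2 ?off ?off1 | split; lia] | lia].
- by case=> _; case: ltnP => ? [? ? ? ?] [? ?]; lia.
- by case=> ? ? [_]; case: ltnP => ? [? ? ? ?]; lia.
Qed.

(** * Toggles and the recursion for [r] *)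

Lemma letter_toggle_src1 k : letter_toggle k (src1 k) = tgt1 k.
Proof. by rewrite /letter_toggle /= inE eqxx /= tpermL /tgt1; case: is_last. Qed.

Lemma letter_toggle_tgt1 k : letter_toggle k (tgt1 k) = src1 k.
Proof.
by rewrite /letter_toggle /= !inE eqxx orbT /= tpermR /src1; case: is_last.
Qed.

Lemma letter_toggle_src2 k : letter_toggle k (src2 k) = tgt2 k.
Proof.
by rewrite /letter_toggle /= !inE eqxx orbT /= tpermR /tgt2; case: is_last.
Qed.

Lemma letter_toggle_tgt2 k : letter_toggle k (tgt2 k) = src2 k.
Proof. by rewrite /letter_toggle /= inE eqxx /= tpermL /src2; case: is_last. Qed.

Lemma mem_node_letters k x : (x \in node_letters k) = (x.1 \in [:: lo k; hi k]).
Proof.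
case: x => i c; rewrite !inE /src1 /tgt1 /src2 /tgt2 !xpair_eqE /=.
by case: (i == lo k); case: (i == hi k); case: c; case: is_last.
Qed.

Lemma letter_toggle_off k x : x \notin node_letters k -> letter_toggle k x = x.
Proof. by rewrite mem_node_letters /letter_toggle => /negPf ->. Qed.

Lemma letter_toggleK k : involutive (letter_toggle k).
Proof.
move=> x; case: (boolP (x \in node_letters k)) => [|xk]; last first.
  by rewrite !letter_toggle_off.
rewrite !inE => /or4P[]/eqP ->;
  by rewrite ?(letter_toggle_src1, letter_toggle_tgt1, letter_toggle_src2,
               letter_toggle_tgt2).
Qed.

Lemma count_letter_toggle k x (s : seq (letter m)) :
  count_mem x (map (letter_toggle k) s) = count_mem (letter_toggle k x) s.
Proof.
rewrite count_map; apply: eq_count => y /=.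
exact: (can2_eq (letter_toggleK k) (letter_toggleK k)).
Qed.

(** For either value of [is_last k], each replacement turns one [tgt1 k] into [src1 k] and one
    [src2 k] into [tgt2 k]. *)
Lemma count_replace_pairs k (s : seq (letter m)) :
  let s' := replace_pairs (lo k) (hi k) s in
  (forall z, z \notin node_letters k -> count_mem z s' = count_mem z s) /\
  [/\ count_mem (src1 k) s' + count_mem (tgt1 k) s' =
        count_mem (src1 k) s + count_mem (tgt1 k) s,
      count_mem (src2 k) s' + count_mem (tgt2 k) s' =
        count_mem (src2 k) s + count_mem (tgt2 k) s &
      count_mem (src1 k) s' + count_mem (tgt2 k) s =
        count_mem (src1 k) s + count_mem (tgt2 k) s'].
Proof.
rewrite /= /replace_pairs; move: (size s) => d.
elim: d => //= d; set t := iter d _ s; move: t => t [off [h1 h2 h3]].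
rewrite /replace_pair; case: ifP => // /andP[t1 t2].
have /seq.permP cE := perm_replace_pair (lo k) t1 t2.
have E := node_letter_neqs hm k.
have cE' z : count_mem z [:: (lo k, false), (lo k, true) &
      rem (hi k, false) (rem (hi k, true) t)] + (tgt1 k == z) + (src2 k == z) =
    count_mem z t + (src1 k == z) + (tgt2 k == z).
  have := cE (pred1 z); rewrite /= /src1 /tgt1 /src2 /tgt2.
  by case: is_last => /=; lia.
move: (_ :: _) cE' => u cE' {cE}; split.
  move=> z zk; rewrite -off //; have := cE' z.
  move: zk; rewrite !inE !negb_or => /and4P[].
  by rewrite ![z == _]eq_sym => /negPf-> /negPf-> /negPf-> /negPf->; rewrite !addn0.
have := (cE' (src1 k), cE' (tgt1 k), cE' (src2 k), cE' (tgt2 k)).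
by rewrite !eqxx !E; case=> [[[]]] /= *; split; lia.
Qed.

Lemma cnt_toggle k b x : ~~ is_last (hi k) ->
  cnt x (toggle k b) = cnt (letter_toggle k x) b.
Proof.
move=> nl; rewrite /cnt toggleE // /toggle_seq (negPf nl) count_sort.
exact: count_letter_toggle.
Qed.

(** The exchange of letters makes the counts [b, a, d, c], and replacing pairs keeps [a' + b'],
    [c' + d'] and [a' - d']. Both minima vanish by [spin_counts]. *)
Lemma reversal_toggle k b : is_last (hi k) -> reversal k b (toggle k b).
Proof.
move=> lk; have q' := spin_counts (toggle k b) lk; have q := spin_counts b lk.
have cE x : cnt x (toggle k b) =
    count_mem x (replace_pairs (lo k) (hi k) (map (letter_toggle k) b)).
  by rewrite /cnt toggleE // /toggle_seq lk count_sort.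
have [off] := count_replace_pairs k (map (letter_toggle k) b).
rewrite -!cE !count_letter_toggle letter_toggle_src1 letter_toggle_tgt1.
rewrite letter_toggle_src2 letter_toggle_tgt2 -!/(cnt _ _) => -[h1 h2 h3].
split; [split|] => [z zk||]; last by lia.
  by rewrite cE off // count_letter_toggle letter_toggle_off.
by split; lia.
Qed.

(** The nodes [k] and [k'] share the letters [tgt1 k = src1 k'] and [src2 k = tgt2 k'], so the
    composite changes at most six counts, to which [reversal4_braid] applies. *)
Lemma reversal_braid k k' (r' : row m n -> row m n) b :
    k.+2 < m -> k' = k.+1 :> nat ->
    (forall b, reversal k' b (r' b)) ->
  reversal k b (r' (toggle k (r' (toggle k (r' b))))).
Proof.
move=> ltk k'E rev'.
have := val_lo_hi k hm; have := val_lo_hi k' hm; rewrite /is_last k'E.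
rewrite !ifN ?neq_ltn ?ltk ?(ltnW ltk) // => -[lo' hi'] [lok hik].
have nk : is_last k = false by rewrite /is_last; lia.
have nk' : is_last k' = false by rewrite /is_last; lia.
have hk : hi k = k' by apply/val_inj; rewrite /= hik k'E.
have lk : lo k = k by apply/val_inj.
have lk' : lo k' = k' by apply/val_inj; rewrite /= lo' k'E.
have nh : ~~ is_last (hi k) by rewrite hk nk'.
have s1' : src1 k' = tgt1 k by rewrite /src1 /tgt1 nk lk' hk.
have t2' : tgt2 k' = src2 k by rewrite /src2 /tgt2 nk lk' hk.
(* Thus [r'] fixes the counts of index [k], and [toggle k] those of index [hi k']. *)
have out x : x.1 = k -> x \notin node_letters k'.
  by move=> xk; rewrite mem_node_letters !inE xk -!val_eqE /=; lia.
have out' x : x.1 = hi k' -> x \notin node_letters k.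
  by move=> xk; rewrite mem_node_letters !inE xk -!val_eqE /=; lia.
have R b0 : reversal4 (cnt (tgt1 k) b0) (cnt (tgt1 k') b0) (cnt (src2 k') b0)
    (cnt (src2 k) b0) (cnt (tgt1 k) (r' b0)) (cnt (tgt1 k') (r' b0))
    (cnt (src2 k') (r' b0)) (cnt (src2 k) (r' b0)).
  by have [[_ []]] := rev' b0; rewrite s1' t2'.
have off b0 z : z \notin node_letters k' -> cnt z (r' b0) = cnt z b0.
  by have [[+ _] _] := rev' b0; apply.
have off1 b0 : cnt (src1 k) (r' b0) = cnt (src1 k) b0.
  by apply/off/out; rewrite /= lk.
have off2 b0 : cnt (tgt2 k) (r' b0) = cnt (tgt2 k) b0.
  by apply/off/out; rewrite /= lk.
have tog z b0 : cnt z (toggle k b0) = cnt (letter_toggle k z) b0.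
  exact: cnt_toggle.
have togs b0 :
    ((cnt (src1 k) (toggle k b0) = cnt (tgt1 k) b0) *
     (cnt (tgt1 k) (toggle k b0) = cnt (src1 k) b0) *
     (cnt (src2 k) (toggle k b0) = cnt (tgt2 k) b0) *
     (cnt (tgt2 k) (toggle k b0) = cnt (src2 k) b0) *
     (cnt (tgt1 k') (toggle k b0) = cnt (tgt1 k') b0) *
     (cnt (src2 k') (toggle k b0) = cnt (src2 k') b0))%type.
  by rewrite !tog letter_toggle_src1 letter_toggle_tgt1 letter_toggle_src2
    letter_toggle_tgt2 !(letter_toggle_off (out' _ _)).
set b2 := toggle k (r' b); set b4 := toggle k (r' b2).
have R1 := R b; have R2 := R b2; have R3 := R b4.
(* The counts entering the later factors [r'] are expressed by those of [b] and those leaving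
   earlier factors, as [reversal4_braid] requires. *)
rewrite {1 2 3 4}/b2 !togs off1 off2 in R2.
rewrite {1 2 3 4}/b4 !togs off1 off2 {1 2}/b2 !togs in R3.
have [r3E [q3E [h1 [h2 [h3 h4]]]]] := reversal4_braid R1 R2 R3.
have off1' : cnt (src1 k) (r' b4) = cnt (tgt1 k) (r' b2) by rewrite off1 togs.
have off2' : cnt (tgt2 k) (r' b4) = cnt (src2 k) (r' b2) by rewrite off2 togs.
split; last by rewrite off1' off2'.
split; last by rewrite off1' off2'; split; lia.
(* Outside node [k], the letters of node [k'] have index [hi k'] and their counts are restored by
   the third factor; the other letters are fixed throughout. *)
move=> z zk; have [zk'|zk'] := boolP (z \in node_letters k'); last first.
  by rewrite !(off, tog, letter_toggle_off).
by move: zk' zk; rewrite !inE s1' t2' => /or4P[]/eqP ->; rewrite ?eqxx ?orbT.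
Qed.

(** Induction on the recursion depth [m - k.+2], which is 0 exactly at the spin nodes. *)
Lemma r_reversal k b : reversal k b (r k b).
Proof.
move: {2}(m - k.+2) (erefl (m - k.+2)) => d; elim: d k b => [|d IH] k b dE.
  rewrite r_spin; last by rewrite -subn_eq0 dE.
  apply: reversal_toggle; have := val_lo_hi k hm; have := ltn_ord k.
  by rewrite /is_last; case: eqP; lia.
have ltk : k.+2 < m by lia.
pose k' : 'I_m := Ordinal (ltnW ltk).
rewrite (r_recE n ltk (erefl : k' = k.+1 :> nat)) /=.
have dE' : m - k'.+2 = d by rewrite /= subnS dE.
exact: (reversal_braid b ltk (erefl : k' = k.+1 :> nat) (fun b0 => IH k' b0 dE')).
Qed.

End Counts.

(** * Weights, and the longest element for a single node *)

Section Weights.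
Import GRing.Theory.
Local Open Scope ring_scope.

Variables (m : nat) (hm : (3 <= m)%N).
Implicit Types (k j : 'I_m) (v w : weight m).

(** The coefficient of [eps (hi k)] in [simple_root k]. *)
Definition root_sign k : int := if is_last k then 1 else -1.

Lemma simple_rootE k j :
  simple_root k 0 j = (j == lo k)%:R + root_sign k * (j == hi k)%:R.
Proof.
rewrite /simple_root /root_sign /eps.
by case: is_last; rewrite !mxE eqxx /= ?mul1r ?mulN1r.
Qed.

Lemma dot_simple_root k v :
  dot v (simple_root k) = v 0 (lo k) + root_sign k * v 0 (hi k).
Proof.
have dot_delta (f : 'I_m -> int) i : \sum_(j < m) f j * (j == i)%:R = f i.
  rewrite (bigD1 i) //= eqxx mulr1 big1 ?addr0 // => j /negPf ->.
  by rewrite mulr0.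
rewrite -[v 0 (lo k)]dot_delta -[v 0 (hi k)]dot_delta mulr_sumr -big_split.
by apply: eq_bigr => j _ /=; rewrite simple_rootE mulrDr mulrCA.
Qed.

Lemma simple_reflectionE k v j :
  simple_reflection k v 0 j =
    if j == lo k then - root_sign k * v 0 (hi k)
    else if j == hi k then - root_sign k * v 0 (lo k)
    else v 0 j.
Proof.
rewrite /simple_reflection !mxE simple_rootE dot_simple_root.
have /negPf nlh := lo_neq_hi k hm; rewrite /root_sign.
by case: (j =P lo k) => [->|_]; [rewrite nlh | case: (j =P hi k) => [->|_]];
  case: is_last; rewrite ?(mulr0, addr0, add0r, mulr1) /=; lia.
Qed.

Lemma simple_reflectionK k : involutive (simple_reflection k).
Proof.
move=> v; apply/rowP => j; rewrite !simple_reflectionE.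
rewrite !eqxx [hi k == lo k]eq_sym (negPf (lo_neq_hi k hm)) /root_sign.
by case: (j =P lo k) => [->|_]; [|case: (j =P hi k) => [->|_] //];
  case: is_last; lia.
Qed.

Lemma simple_reflection_root k :
  simple_reflection k (simple_root k) = - simple_root k.
Proof.
apply/rowP => j; rewrite simple_reflectionE mxE !simple_rootE !eqxx.
have /negPf nlh := lo_neq_hi k hm; rewrite [hi k == _]eq_sym nlh /root_sign.
by case: (j =P lo k) => [->|_]; [rewrite nlh | case: (j =P hi k) => _];
  case: is_last.
Qed.

(** A longer word starts with [k] twice, and these two reflections cancel. *)
Lemma reduced_word1_size k (w : seq 'I_m) :
  reduced_word [set k] w -> (size w <= 1)%N.
Proof.
case=> sub red; case: w sub red => [|i [|j w]] // sub red.
have /set1P iE : i \in [set k] by apply: sub; rewrite !inE eqxx.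
have /set1P jE : j \in [set k] by apply: sub; rewrite !inE eqxx orbT.
have /= : (size [:: i, j & w] <= size w)%N.
  apply: red => [x xw|v]; first by apply: sub; rewrite !inE xw !orbT.
  by rewrite /= iE jE simple_reflectionK.
by lia.
Qed.

Lemma reduced_word1 k : reduced_word [set k] [:: k].
Proof.
(* The empty word is excluded by the coordinate [lo k] of [simple_root k], which is 1 and becomes -1
   under [s_k]. *)
split=> [j|[|//] _ /(_ (simple_root k))/rowP/(_ (lo k))]; first by rewrite !inE.
rewrite /= simple_reflection_root mxE simple_rootE eqxx.
by rewrite (negPf (lo_neq_hi k hm)) mulr0.
Qed.

Lemma longest_word1 k (w : seq 'I_m) : longest_word [set k] w <-> w = [:: k].
Proof.
split=> [[red long]|->]; last first.
  by split=> [|w']; [exact: reduced_word1 | exact: reduced_word1_size].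
have := reduced_word1_size red; have := long _ (reduced_word1 k).
case: w red {long} => [|i [|//]] // [sub _] _ _.
by have /set1P -> : i \in [set k] by apply: sub; rewrite inE.
Qed.

Variable n : nat.
Implicit Types b : row m n.

Lemma row_wtE b j :
  row_wt b 0 j = (cnt (j, false) b)%:Z - (cnt (j, true) b)%:Z.
Proof.
rewrite /cnt !count_mem_tnth -!natz !natr_sum -sumrB summxE.
apply: eq_bigr => p _.
case: (tnth b p) => i c; rewrite /letter_wt /eps !xpair_eqE /=.
by case: c; rewrite !mxE eqxx ?andbT ?andbF /= [j == i]eq_sym ?subr0 ?sub0r.
Qed.

(** The coordinates [lo k] and [hi k] of the weight are [a - d] and, up to the sign [- root_sign k],
    [b - c]; a reversal exchanges these two differences. *)
Lemma reversal_wt k b b' :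
  reversal k b b' -> row_wt b' = simple_reflection k (row_wt b).
Proof.
case=> -[off [h1 h2 h3]] h4; apply/rowP => j.
rewrite simple_reflectionE !row_wtE.
case: (j =P lo k) => [->|jlo].
  move: h1 h2 h3 h4; rewrite /src1 /src2 /tgt1 /tgt2 /root_sign.
  by case: is_last => /=; lia.
case: (j =P hi k) => [->|jhi].
  move: h1 h2 h3 h4; rewrite /src1 /src2 /tgt1 /tgt2 /root_sign.
  by case: is_last => /=; lia.
have jk c : (j, c) \notin node_letters k.
  by rewrite mem_node_letters !inE negb_or; apply/andP; split; apply/eqP.
by rewrite !off.
Qed.

Lemma same_string_wt_inj k b b' :
  same_string k b b' -> row_wt b' = row_wt b -> b' = b.
Proof.
move=> ss /rowP/(_ (lo k)); rewrite !row_wtE => wtE.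
by apply: (same_string_inj ss); rewrite /src1 /tgt2; lia.
Qed.

End Weights.

Theorem proposition6p1 (m : nat) (hm : 3 <= m) (k : 'I_m)
    (n : nat) (hn : 1 <= n) (c : row m n -> row m n) :
  is_cactus_generator [set k] c <-> c =1 r k.
Proof.
split=> [[w [theta [/(longest_word1 hm) -> _ con wt _]]] b|cE].
  (* Both [c b] and [r k b] lie in the string of [b] and have the same weight, so they coincide. *)
  have rev := r_reversal hm k b.
  have /(connect_same_string hm) ss := con b.
  apply: (same_string_wt_inj hm (k := k)).
    exact: same_string_trans (same_string_sym (proj1 rev)) ss.
  by rewrite wt (reversal_wt hm rev).
have rev b : reversal k b (c b) by rewrite cE; exact: r_reversal.
(* As [s_k] negates [simple_root k], the identity serves as [theta]. *)
exists [:: k], id; split=> [||b|b|j b /set1P ->].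
- exact/longest_word1.
- move=> j jk; split=> //; move/set1P: jk => ->.
  by rewrite /= simple_reflection_root // GRing.opprK.
- by apply/(connect_same_string hm); case: (rev b).
- exact: reversal_wt.
- by split; [exact: reversal_e | exact: reversal_f].
Qed.
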